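(* Let $G$ be one of the groups $D_{2n}$ ($n\ge 3$), $Q_{4m}$ ($m\ge 2$), $U_{(n,m)}$ ($m\ge 2$, $n\ge 2$), $V_{8n}$ ($n\ge 2$) or $SD_{8n}$ ($n\ge 2$). Then $$E(\mathcal{CCC}(G)) \leq LE(\mathcal{CCC}(G)) \quad\text{and}\quad LE^+(\mathcal{CCC}(G)) \leq LE(\mathcal{CCC}(G)).$$ Moreover, $LE(\mathcal{CCC}(G)) = LE^+(\mathcal{CCC}(G))$ if $G = D_{6}, D_{8}, D_{10}, D_{12}, Q_{8}, Q_{12}, V_{16}, SD_{24}$ or $G=U_{(n,m)}$ with $m \in\{ 2,3,4\}$ and $n\geq 2$. The inequality $LE(\mathcal{G})\le LE^+(\mathcal{G})$ does not hold for all graphs $\mathcal{G}$ of the form $\mathcal{CCC}(G)$ with $G$ among the groups $D_{2n}$ ($n\ge 3$), $Q_{4m}$ ($m\ge 2$), $U_{(n,m)}$ ($m\ge 2$, $n\ge 2$), $V_{8n}$ ($n\ge 2$) and $SD_{8n}$ ($n\ge 2$).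
   Context: The groups are $D_{2n} = \langle x, y : x^n = y^2 = 1,\ yxy = x^{-1}\rangle$, $Q_{4m} = \langle x, y : x^{2m} = 1,\ x^m = y^2,\ y^{-1}xy = x^{-1}\rangle$, $U_{(n,m)} = \langle x, y : x^{2n} = y^m = 1,\ x^{-1}yx = y^{-1}\rangle$, $V_{8n} = \langle x, y : x^{2n} = y^4 = 1,\ yx = x^{-1}y^{-1},\ y^{-1}x = x^{-1}y\rangle$, $SD_{8n} = \langle x, y : x^{4n} = y^2 = 1,\ yxy = x^{2n-1}\rangle$ (the subscripts of $D$, $Q$, $V$, $SD$ are the group orders). For a finite non-abelian group $G$, the commuting conjugacy class graph $\mathcal{CCC}(G)$ is the simple undirected graph whose vertices are the conjugacy classes of the non-central elements of $G$; two distinct vertices $x^G$ and $y^G$ are adjacent iff there exist $x'\in x^G$ and $y'\in y^G$ with $x'y'=y'x'$. For a finite graph $\mathcal{G}$ with adjacency matrix $A(\mathcal{G})$ and (diagonal) degree matrix $D(\mathcal{G})$, put $L(\mathcal{G})=D(\mathcal{G})-A(\mathcal{G})$ and $Q(\mathcal{G})=D(\mathcal{G})+A(\mathcal{G})$, and let $\mathrm{Spec}(\mathcal{G})$, $\mathrm{L\text{-}Spec}(\mathcal{G})$, $\mathrm{Q\text{-}Spec}(\mathcal{G})$ be the multisets of eigenvalues of $A(\mathcal{G})$, $L(\mathcal{G})$, $Q(\mathcal{G})$. With $d=\frac{2|e(\mathcal{G})|}{|V(\mathcal{G})|}$ ($|V(\mathcal{G})|$ the number of vertices, $|e(\mathcal{G})|$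 the number of edges), the energy, Laplacian energy and signless Laplacian energy are $E(\mathcal{G})=\sum_{\lambda\in \mathrm{Spec}(\mathcal{G})}|\lambda|$, $LE(\mathcal{G})=\sum_{\mu\in \mathrm{L\text{-}Spec}(\mathcal{G})}|\mu-d|$, $LE^+(\mathcal{G})=\sum_{\nu\in \mathrm{Q\text{-}Spec}(\mathcal{G})}|\nu-d|$ (sums with multiplicity). *)

(* Defs.v *)
From mathcomp Require Import all_boot all_order all_algebra all_fingroup.
From mathcomp Require Import center.

Set Implicit Arguments.
Unset Strict Implicit.
Unset Printing Implicit Defensive.

Import GroupScope GRing.Theory Num.Theory.

(* [G \isog Grp (...)] only quantifies over finite groups, so it says that G
   is the largest finite quotient of the presented group; for positive
   parameters each presented group below is finite, so this is isomorphism
   with the presented group. *)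

Definition is_D (n : nat) (gT : finGroupType) (G : {group gT}) : Prop :=
  G \isog Grp (x : y : x ^+ n = y ^+ 2 = 1, y * x * y = x^-1).

Definition is_Q (m : nat) (gT : finGroupType) (G : {group gT}) : Prop :=
  G \isog Grp (x : y : x ^+ (2 * m) = 1, x ^+ m = y ^+ 2,
                       y^-1 * x * y = x^-1).

(* For m = 2 this group is abelian. *)
Definition is_U (n m : nat) (gT : finGroupType) (G : {group gT}) : Prop :=
  G \isog Grp (x : y : x ^+ (2 * n) = y ^+ m = 1, x^-1 * y * x = y^-1).

Definition is_V (n : nat) (gT : finGroupType) (G : {group gT}) : Prop :=
  G \isog Grp (x : y : x ^+ (2 * n) = y ^+ 4 = 1, y * x = x^-1 * y^-1,
                       y^-1 * x = x^-1 * y).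

Definition is_SD (n : nat) (gT : finGroupType) (G : {group gT}) : Prop :=
  G \isog Grp (x : y : x ^+ (4 * n) = y ^+ 2 = 1,
                       y * x * y = x ^+ (2 * n - 1)).

Definition in_DQUVSD (gT : finGroupType) (G : {group gT}) : Prop :=
  [\/ exists2 n, 3 <= n & is_D n G,
      exists2 m, 2 <= m & is_Q m G,
      exists n m, [/\ 2 <= n, 2 <= m & is_U n m G] |
      (exists2 n, 2 <= n & is_V n G) \/ (exists2 n, 2 <= n & is_SD n G)].

Record sgraph := SGraph {
  vertex :> finType;
  adj : rel vertex;
  adj_sym : symmetric adj;
  adj_irr : irreflexive adj }.

Section CommutingConjugacyClassGraph.

Variables (gT : finGroupType) (G : {group gT}).

Definition noncentral_classes : {set {set gT}} :=
  [set x ^: G | x in G :\: 'Z(G)].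

Definition ccc_vertex : finType := {X : {set gT} | X \in noncentral_classes}.

Definition ccc_adj : rel ccc_vertex := fun X Y =>
  (X != Y) && [exists x in val X, exists y in val Y, x * y == y * x].

Lemma ccc_adj_sym : symmetric ccc_adj.
Proof.
suff sub X Y : ccc_adj X Y -> ccc_adj Y X.
  by move=> X Y; apply/idP/idP; apply: sub.
case/andP=> nXY /exists_inP[x Xx /exists_inP[y Yy /eqP xy]].
rewrite /ccc_adj eq_sym nXY; apply/exists_inP; exists y => //.
by apply/exists_inP; exists x => //; rewrite xy.
Qed.

Lemma ccc_adj_irr : irreflexive ccc_adj.
Proof. by move=> X; rewrite /ccc_adj eqxx. Qed.

Definition CCC : sgraph := SGraph ccc_adj_sym ccc_adj_irr.

End CommutingConjugacyClassGraph.

Local Open Scope ring_scope.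

Definition edges (g : sgraph) : {set {set g}} :=
  [set [set p.1; p.2] | p : g * g & adj p.1 p.2].

Definition degree (g : sgraph) (v : g) : nat := #|[set w | adj v w]|.

(* The multiset of eigenvalues, as the list of roots of the characteristic
   polynomial with multiplicity (its order is irrelevant). *)
Definition spectrum (C : numClosedFieldType) (n : nat) (A : 'M[C]_n) : seq C :=
  sval (closed_field_poly_normal (char_poly A)).

Section Energies.

(* Eigenvalues live in an algebraically closed field with a norm, such as the
   complex numbers; there [x <= y] means that y - x is real and nonnegative. *)
Variables (C : numClosedFieldType) (g : sgraph).

Definition adj_mx : 'M[C]_#|g| :=
  \matrix_(i, j) (adj (enum_val i) (enum_val j))%:R.

Definition deg_mx : 'M[C]_#|g| :=
  diag_mx (\row_i (degree (enum_val i))%:R).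

Definition lap_mx : 'M[C]_#|g| := deg_mx - adj_mx.

Definition slap_mx : 'M[C]_#|g| := deg_mx + adj_mx.

(* This is 0 for the graph without vertices, since x / 0 = 0. *)
Definition avg_degree : C := (2 * #|edges g|)%:R / #|g|%:R.

Definition energy : C := \sum_(l <- spectrum adj_mx) `|l|.

Definition lap_energy : C := \sum_(l <- spectrum lap_mx) `|l - avg_degree|.

Definition slap_energy : C := \sum_(l <- spectrum slap_mx) `|l - avg_degree|.

End Energies.

Arguments energy C g : clear implicits.
Arguments lap_energy C g : clear implicits.
Arguments slap_energy C g : clear implicits.

(* Main.v *)
Require Import Defs.
From mathcomp Require Import all_boot all_order all_algebra all_fingroup.
From mathcomp Require Import commutator cyclic center pgroup extremal.
From mathcomp Require Import ring lra zify.

(* Each of the groups is abelian or has an abelian subgroup A of index 2 and an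
   element t outside A such that the commutators [t, a], for a in A, form a
   cyclic group W.  Put z = |Z(G)| and c = |W|, so that |A| = z * c.  The
   noncentral classes inside A have two elements and commute pairwise; a class
   outside A is a coset u * W, and two such classes are adjacent exactly when
   they lie in the same coset of Z(G) * W, a subgroup of A whose index
   |Z(G) :&: W| is 1 or 2 according to the parity of c.  Hence CCC(G) is the
   disjoint union of K_(z(c-1)/2) with K_z (c odd) or with 2 K_(z/2) (c even).
   The eigenvalues, and so the energies, of a disjoint union of complete graphs
   are rational and explicit, and the claims become inequalities in z and c. *)

Set Implicit Arguments.
Unset Strict Implicit.
Unset Printing Implicit Defensive.

Import Order.TTheory GRing.Theory Num.Theory.

Local Open Scope ring_scope.

(** * Spectra and energies of disjoint unions of complete graphs *)

Section Spectrum.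

Variable C : numClosedFieldType.

(** The factors [s] replace a division: the characteristic polynomial is needed only up to known
    linear factors, and unique factorization identifies the multisets of roots. *)
Lemma perm_eq_spectrum n (A : 'M[C]_n) (s t : seq C) :
  char_poly A * \prod_(z <- s) ('X - z%:P) = \prod_(z <- t) ('X - z%:P) ->
  perm_eq (spectrum A ++ s) t.
Proof.
rewrite /spectrum; case: closed_field_poly_normal => r /= ->.
rewrite (monicP (char_poly_monic A)) scale1r -big_cat /=.
by move/prod_XsubC_eq.
Qed.

(* Both sides of [det_prod] below are the determinant of the same block
   matrix; this avoids inverting [diag_mx (alpha \o f)] as in the matrix
   determinant lemma. *)
Lemma char_poly_diag_add_block n k (f : 'I_n -> 'I_k) (alpha : 'I_k -> C)
    (beta : C) :
  char_poly (\matrix_(i, j) (alpha (f i) *+ (i == j) + beta *+ (f i == f j)))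
    * \prod_i ('X - (alpha i)%:P)
  = \prod_i ('X - (alpha (f i))%:P)
    * \prod_i ('X - (alpha i + beta * #|[set j | f j == i]|%:R)%:P).
Proof.
pose L : 'M[{poly C}]_n := diag_mx (\row_i ('X - (alpha (f i))%:P)).
(* [B] is the incidence matrix of indices and blocks: [B *m B^T] is the block part of the matrix,
   while [B^T *m B] is diagonal and holds the block sizes. *)
pose B : 'M[{poly C}]_(n, k) := \matrix_(i, j) (f i == j)%:R.
pose Dk : 'M[{poly C}]_k := diag_mx (\row_i ('X - (alpha i)%:P)).
pose E : 'M[{poly C}]_k :=
  diag_mx (\row_i ('X - (alpha i + beta * #|[set j | f j == i]|%:R)%:P)).
have LB : L *m B = B *m Dk.
  apply/matrixP=> i j; rewrite mul_diag_mx mul_mx_diag !mxE.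
  by case: eqP => [->|_]; rewrite ?mulr1 ?mul1r ?mulr0 ?mul0r.
have BB : Dk - beta%:P *: (B^T *m B) = E.
  apply/matrixP=> i j; rewrite !mxE.
  under eq_bigr => l _ do rewrite !mxE -natrM mulnb.
  case: eqP => [<-|ij]; last first.
    rewrite !mulr0n sub0r big1 ?mulr0 ?oppr0 // => l _.
    by case: eqP => //= ->; case: eqP.
  rewrite !mulr1n -natr_sum polyCD polyCM opprD addrA polyC_natr.
  congr (_ - _ * _%:R); rewrite -sum1dep_card [RHS]big_mkcond.
  by apply: eq_bigr => l _; rewrite andbb; case: eqP.
pose M := \matrix_(i, j) (alpha (f i) *+ (i == j) + beta *+ (f i == f j)).
have ML : char_poly_mx M = L - beta%:P *: (B *m B^T).
  apply/matrixP=> i j; rewrite !mxE.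
  have -> : \sum_j0 B i j0 * B^T j0 j = (f i == f j)%:R.
    rewrite (bigD1 (f i)) //= !mxE eqxx mul1r big1 ?addr0 ?(eq_sym (f j)) //.
    by move=> l /negbTE nl; rewrite !mxE eq_sym nl mul0r.
  rewrite polyCD opprD addrA; case: eqP => [->|_];
  by case: eqP => _; rewrite ?mulr1n ?mulr0n ?mulr1 ?mulr0 ?polyC0 ?subr0.
have det_prod : \det (char_poly_mx M) * \det Dk = \det L * \det E.
  rewrite -(mulr1 (\det (char_poly_mx M))) -(det1 _ k).
  rewrite -(det_ublock _ (beta%:P *: B)).
  have -> : block_mx (char_poly_mx M) (beta%:P *: B) 0 1%:M =
      block_mx L (beta%:P *: B) B^T 1%:M *m block_mx 1%:M 0 (- B^T) 1%:M.
    rewrite mulmx_block !mulmx1 !mulmx0 !mul1mx !add0r mulmxN subrr ML.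
    by rewrite -scalemxAl.
  rewrite det_mulmx det_lblock !det1 !mulr1 -[\det Dk]mul1r.
  (* Multiply the block matrix on the right by an upper triangular one with diagonal blocks 1 and
     [Dk]: [LB] clears the upper right block and [BB] makes the lower right one [E]. *)
  rewrite -{2}(det1 {poly C} n) -(det_ublock _ (- (beta%:P *: B))) -det_mulmx.
  rewrite mulmx_block !mulmx1 !mulmx0 !mul1mx !addr0 mulmxN -scalemxAr.
  by rewrite -scalemxAl LB addNr mulmxN -scalemxAr addrC BB det_lblock.
have detE m (F : 'I_m -> {poly C}) : \det (diag_mx (\row_i F i)) = \prod_i F i.
  by rewrite det_diag; apply: eq_bigr => i _; rewrite mxE.
by move: det_prod; rewrite !detE.
Qed.

(** On a block of size m, vectors of sum zero give [alpha i] with multiplicity m - 1, and the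
    constant vector gives [alpha i + beta * m]. For an empty block the coefficient is -1 and the two
    terms cancel. *)
Lemma sum_spectrum_diag_add_block n k (f : 'I_n -> 'I_k) (alpha : 'I_k -> C)
    (beta : C) (F : C -> C) (A : 'M[C]_n)
    (size_of := fun i => #|[set j | f j == i]|) :
  (forall i j, A i j = alpha (f i) *+ (i == j) + beta *+ (f i == f j)) ->
  \sum_(l <- spectrum A) F l
  = \sum_i (((size_of i)%:R - 1) * F (alpha i)
             + F (alpha i + beta * (size_of i)%:R)).
Proof.
move=> AE.
pose s := [seq alpha i | i : 'I_k].
pose t := [seq alpha (f i) | i : 'I_n]
          ++ [seq alpha i + beta * (size_of i)%:R | i : 'I_k].
have st : perm_eq (spectrum A ++ s) t.
  apply: perm_eq_spectrum; rewrite big_cat /= !big_image /=.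
  rewrite -char_poly_diag_add_block; congr (char_poly _ * _).
  by apply/matrixP => i j; rewrite mxE.
have : \sum_(l <- spectrum A ++ s) F l = \sum_(l <- t) F l by exact: perm_big.
rewrite !big_cat /= !big_image /=.
rewrite big_split /= => /(canRL (addrK _)) ->.
rewrite (partition_big f xpredT) //= addrAC -sumrB; congr (_ + _).
apply: eq_bigr => i _; rewrite (eq_bigr (fun=> F (alpha i))); last first.
  by move=> j /eqP->.
by rewrite sumr_const mulrBl mul1r mulr_natl /size_of cardsE.
Qed.

End Spectrum.

(** Handshake lemma: ordered adjacent pairs are grouped by their first vertex, then by the edge they
    span; an edge comes from exactly two pairs because [adj] is irreflexive. *)
Lemma sum_degree (g : sgraph) :
  (\sum_(v : g) degree v)%N = (2 * #|edges g|)%N.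
Proof.
pose ends (p : g * g) := [set p.1; p.2].
have -> : (\sum_(v : g) degree v
           = \sum_(p in [pred p : g * g | adj p.1 p.2]) 1)%N.
  rewrite -(pair_big_dep xpredT (fun v w : g => adj v w) (fun _ _ => 1%N)) /=.
  by apply: eq_bigr => v _; rewrite sum1dep_card.
have edgesE : edges g = [set ends p | p in [pred p : g * g | adj p.1 p.2]].
  by apply/setP=> e; apply/imsetP/imsetP => -[p]; rewrite ?inE => pE ->;
    exists p; rewrite ?inE.
rewrite (partition_big_imset ends) -edgesE mulnC -sum_nat_const.
apply: eq_bigr => e /imsetP[[a b]]; rewrite inE /= => ab ->.
have ab' : a != b by apply: contraTneq ab => ->; rewrite adj_irr.
rewrite sum1dep_card -[RHS](_ : #|[set (a, b); (b, a)]| = _); last first.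
  by rewrite cards2 xpair_eqE negb_and ab'.
apply: eq_card => -[c d]; rewrite !inE /ends /= !xpair_eqE.
apply/andP/orP => [[cd /eqP cdE]|[] /andP[/eqP-> /eqP->]]; last 2 first.
- by rewrite ab eqxx.
- by rewrite adj_sym ab setUC eqxx.
have cd' : c != d by apply: contraTneq cd => ->; rewrite adj_irr.
have : c \in [set a; b] by rewrite -cdE !inE eqxx.
have : d \in [set a; b] by rewrite -cdE !inE eqxx orbT.
rewrite !inE => /orP[] /eqP dE /orP[] /eqP cE;
  move: cd'; rewrite dE cE ?eqxx //.
- by right.
- by left.
Qed.

(** The components are the nonempty fibres of [f]. Empty fibres are permitted, so that ['I_3] serves
    for both two and three cliques. *)
Definition clique_union (g : sgraph) k (f : g -> 'I_k) :=
  forall v w : g, adj v w = (v != w) && (f v == f w).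

(* Contribution of a complete component with [a] vertices to the energies of a
   graph of average degree [d]; it vanishes for [a = 0]. *)
Definition clique_energy (R : numDomainType) (a : R) := a - 1 + `|a - 1|.

Definition clique_lap_energy (R : numDomainType) (d a : R) :=
  (a - 1) * `|a - d| + `|d|.

Definition clique_slap_energy (R : numDomainType) (d a : R) :=
  (a - 1) * `|a - 2 - d| + `|2 * a - 2 - d|.

Lemma clique_energy0 (R : numDomainType) : clique_energy 0 = 0 :> R.
Proof. by rewrite /clique_energy sub0r normrN1 addNr. Qed.

Lemma clique_lap_energy0 (R : numDomainType) (d : R) :
  clique_lap_energy d 0 = 0.
Proof. by rewrite /clique_lap_energy !sub0r mulN1r normrN addNr. Qed.

Lemma clique_slap_energy0 (R : numDomainType) (d : R) :
  clique_slap_energy d 0 = 0.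
Proof. by rewrite /clique_slap_energy mulr0 !sub0r mulN1r addNr. Qed.

Section CliqueEnergies.

Variables (k : nat) (n : 'I_k -> nat).

(** The computations take place in [rat], whose order is total, and are carried to [C] by [ratr]. *)
Definition cliques_degree : rat :=
  (\sum_i (n i)%:R * ((n i)%:R - 1)) / \sum_i (n i)%:R.

Definition cliques_energy : rat := \sum_i clique_energy (n i)%:R.

Definition cliques_lap_energy : rat :=
  \sum_i clique_lap_energy cliques_degree (n i)%:R.

Definition cliques_slap_energy : rat :=
  \sum_i clique_slap_energy cliques_degree (n i)%:R.

End CliqueEnergies.

Section CliqueUnion.

Definition class_size (T : finType) k (f : T -> 'I_k) i :=
  #|[set v | f v == i]|.

Variables (C : numClosedFieldType) (g : sgraph) (k : nat) (f : g -> 'I_k).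
Hypothesis gE : clique_union f.

Lemma degree_clique_union (R : pzRingType) v :
  (degree v)%:R = (class_size f (f v))%:R - 1 :> R.
Proof.
rewrite /class_size (cardsD1 v) inE eqxx /= add1n -natr1 addrK; congr _%:R.
by apply: eq_card => w; rewrite !inE gE eq_sym (eq_sym (f v)).
Qed.

Lemma class_size_enum i :
  #|[set j : 'I_#|g| | f (enum_val j) == i]| = class_size f i.
Proof.
rewrite /class_size -[RHS](on_card_preimset (f := @enum_val g g)).
  by apply: eq_card => j; rewrite !inE.
by apply: onW_bij; apply: enum_val_bij.
Qed.

Lemma sum_class_size : (\sum_i class_size f i = #|g|)%N.
Proof.
rewrite -sum1_card (partition_big f xpredT) //=; apply: eq_bigr => i _.
by rewrite sum1dep_card.
Qed.

Lemma avg_degree_clique_union :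
  avg_degree C g = ratr (cliques_degree (class_size f)).
Proof.
rewrite /avg_degree -sum_degree /cliques_degree fmorph_div /=.
rewrite -natr_sum sum_class_size.
congr (_ / _); last by rewrite rmorph_nat.
rewrite natr_sum (partition_big f xpredT) //= rmorph_sum /=.
apply: eq_bigr => i _.
rewrite (eq_bigr (fun=> (class_size f i)%:R - 1)) => [|v /eqP<-]; last first.
  exact: degree_clique_union.
rewrite sumr_const -cardsE -[#|_|]/(class_size f i).
rewrite rmorphM rmorphB rmorph1 !rmorph_nat.
by rewrite [RHS]mulr_natl.
Qed.

Lemma energy_clique_union :
  energy C g = ratr (cliques_energy (class_size f)).
Proof.
rewrite /energy.
(* With J the all-ones matrix, a clique on a vertices has adjacency matrix J - 1, with eigenvalues
   -1 and a - 1. *)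
rewrite (@sum_spectrum_diag_add_block _ _ _ (f \o enum_val) (fun=> -1) 1).
  rewrite rmorph_sum; apply: eq_bigr => i _; rewrite class_size_enum.
  rewrite normrN1 mulr1 mul1r [-1 + _]addrC /clique_energy rmorphD /= ratr_norm.
  by rewrite !rmorphB rmorph1 !rmorph_nat.
move=> i j; rewrite mxE gE (inj_eq enum_val_inj) /=.
by case: eqP => [->|_]; rewrite ?eqxx /= ?addNr ?add0r.
Qed.

Lemma lap_energy_clique_union :
  lap_energy C g = ratr (cliques_lap_energy (class_size f)).
Proof.
rewrite /lap_energy avg_degree_clique_union /cliques_lap_energy.
move: (cliques_degree _) => d.
(* On a clique the Laplacian is a - J, with eigenvalues a and 0. *)
rewrite (@sum_spectrum_diag_add_block _ _ _ (f \o enum_val)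
           (fun i => (class_size f i)%:R) (-1)).
  rewrite rmorph_sum; apply: eq_bigr => i _; rewrite class_size_enum.
  rewrite mulN1r subrr sub0r normrN /clique_lap_energy rmorphD rmorphM /=.
  by rewrite !ratr_norm !rmorphB rmorph1 !rmorph_nat.
move=> i j; rewrite !mxE gE (inj_eq enum_val_inj) /= degree_clique_union.
case: eqP => [->|_]; rewrite ?eqxx !(mulr1n, mulr0n, subr0, addr0) //=.
by rewrite mulNrn.
Qed.

Lemma slap_energy_clique_union :
  slap_energy C g = ratr (cliques_slap_energy (class_size f)).
Proof.
rewrite /slap_energy avg_degree_clique_union /cliques_slap_energy.
move: (cliques_degree _) => d.
(* On a clique the signless Laplacian is (a - 2) + J, with eigenvalues a - 2 and 2a - 2. *)
rewrite (@sum_spectrum_diag_add_block _ _ _ (f \o enum_val)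
           (fun i => (class_size f i)%:R - 2) 1).
  rewrite rmorph_sum; apply: eq_bigr => i _; rewrite class_size_enum.
  rewrite /clique_slap_energy rmorphD rmorphM /= !ratr_norm.
  rewrite !rmorphB rmorphM rmorph1 !rmorph_nat.
  by rewrite mul1r [2 * _]mulr_natl [_ - 2 + _%:R]addrAC -mulr2n.
move=> i j; rewrite !mxE gE (inj_eq enum_val_inj) /= degree_clique_union.
case: eqP => [->|_]; rewrite ?eqxx !(mulr1n, mulr0n, addr0) //=.
ring.
Qed.

End CliqueUnion.

(** * Comparison of the energies for the clique sizes that occur *)

Section CliqueEnergyComparison.

Variables (R : realFieldType) (r c d : R).

(** Equal cliques form a regular graph of degree d, where L - d = -A and Q - d = A, so all three
    energies agree. *)
Lemma equal_cliques_energies : d = c - 1 ->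
  clique_energy c = clique_lap_energy d c /\
  clique_slap_energy d c = clique_lap_energy d c.
Proof.
move=> ->; rewrite /clique_energy /clique_lap_energy /clique_slap_energy.
have -> : c - (c - 1) = 1 by ring.
have -> : c - 2 - (c - 1) = - 1 by ring.
have -> : 2 * c - 2 - (c - 1) = c - 1 by ring.
by rewrite normrN normr1 mulr1.
Qed.

Lemma two_equal_cliques_degree : 1 <= c ->
  d * (c + c) = c * (c - 1) + c * (c - 1) -> d = c - 1.
Proof.
move=> c1 dE; have cc : c + c != 0 by apply: lt0r_neq0; lra.
by apply: (mulIf cc); lra.
Qed.

Lemma three_equal_cliques_degree : 1 <= c ->
  d * (c + c + c) = c * (c - 1) + c * (c - 1) + c * (c - 1) -> d = c - 1.
Proof.
move=> c1 dE; have cc : c + c + c != 0 by apply: lt0r_neq0; lra.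
by apply: (mulIf cc); lra.
Qed.

(* [s], introduced in this proof and the next, is what the largest Laplacian
   eigenvalue [r * c] exceeds [d + 1] by. *)
Lemma two_cliques_energies : 1 <= c -> 2 <= r -> c = 1 \/ 2 <= c ->
  d * (r * c + c) = r * c * (r * c - 1) + c * (c - 1) ->
  [/\ clique_energy (r * c) + clique_energy c
      <= clique_lap_energy d (r * c) + clique_lap_energy d c,
      clique_slap_energy d (r * c) + clique_slap_energy d c
      <= clique_lap_energy d (r * c) + clique_lap_energy d c &
      r = 2 -> c = 1 ->
      clique_slap_energy d (r * c) + clique_slap_energy d c
      = clique_lap_energy d (r * c) + clique_lap_energy d c].
Proof.
move=> c1 r2 c12 dE.
have [s ds] : {s | d = r * c - 1 - s} by exists (r * c - 1 - d); ring.
have cN0 : c != 0 by apply: lt0r_neq0; lra.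
have sE : s * (r + 1) = c * (r - 1).
  by apply: (mulfI cN0); move: dE; rewrite ds; lra.
(* The ratio [s / c] is [(r - 1) / (r + 1)], which lies in [1/3, 1) for [r >= 2]. *)
have s_ge : c <= 3 * s by nra.
have s_lt : s < c by nra.
have d_ge0 : 0 <= d by nra.
have rc : 2 * c <= r * c by nra.
have rs : 2 * s <= r * s by nra.
have lapE : clique_lap_energy d (r * c) + clique_lap_energy d c
    = 2 * (r * c - 1) * (1 + s).
  rewrite /clique_lap_energy (ger0_norm d_ge0).
  have -> : r * c - d = 1 + s by rewrite ds; ring.
  have -> : c - d = 1 - r * s by rewrite ds; lra.
  rewrite ger0_norm; last lra.
  (* For [c = 1] the factor [c - 1] vanishes, whatever the sign of [1 - r * s]; for [c >= 2],
     [r * s >= 2 * s >= 4 / 3]. *)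
  have -> : (c - 1) * `|1 - r * s| = (c - 1) * (r * s - 1).
    have [->|c2] := c12; first by rewrite subrr !mul0r.
    by rewrite ler0_norm ?opprB //; lra.
  by rewrite ds; lra.
have enE : clique_energy (r * c) + clique_energy c
    = 2 * (r * c - 1) + 2 * (c - 1).
  by rewrite /clique_energy !ger0_norm; lra.
have slapE : clique_slap_energy d (r * c) + clique_slap_energy d c
    = (r * c - 1) * `|s - 1| + (r * c - 1 + s)
      + (c - 1) * (r * s + 1) + `|c - 1 - r * s|.
  rewrite /clique_slap_energy.
  have -> : r * c - 2 - d = s - 1 by rewrite ds; ring.
  have -> : 2 * (r * c) - 2 - d = r * c - 1 + s by rewrite ds; ring.
  have -> : c - 2 - d = - (r * s + 1) by rewrite ds; lra.
  have -> : 2 * c - 2 - d = c - 1 - r * s by rewrite ds; lra.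
  rewrite normrN (ger0_norm (_ : 0 <= r * c - 1 + s)); last lra.
  by rewrite (ger0_norm (_ : 0 <= r * s + 1)) ?addrA //; nra.
have prod_ge : 0 <= (r * c - 2) * s by apply: mulr_ge0; lra.
rewrite lapE enE slapE; split.
- nra.
- have [q0|q0] := leP 0 (c - 1 - r * s); have [s1|s1] := leP 0 (s - 1);
  rewrite ?(ger0_norm q0) ?(ltr0_norm q0) ?(ger0_norm s1) ?(ltr0_norm s1);
  nra.
(* Cliques of sizes 2 and 1, as for D_10. *)
move=> r2' cE; move: sE; rewrite r2' cE => sE.
have -> : s = 1 / 3 by lra.
by rewrite ltr0_norm; last lra; rewrite ler0_norm; lra.
Qed.

(** From [r >= 3] follow [s >= 4 * c / 5] and [r * s / 2 >= 6 * c / 5], which fix every sign except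
    that of [s - 1]. *)
Lemma three_cliques_energies : 1 <= c -> 3 <= r ->
  d * (r * c + c + c) = r * c * (r * c - 1) + c * (c - 1) + c * (c - 1) ->
  clique_energy (r * c) + clique_energy c + clique_energy c
  <= clique_lap_energy d (r * c) + clique_lap_energy d c
     + clique_lap_energy d c /\
  clique_slap_energy d (r * c) + clique_slap_energy d c
    + clique_slap_energy d c
  <= clique_lap_energy d (r * c) + clique_lap_energy d c
     + clique_lap_energy d c.
Proof.
move=> c1 r3 dE.
have [s ds] : {s | d = r * c - 1 - s} by exists (r * c - 1 - d); ring.
have cN0 : c != 0 by apply: lt0r_neq0; lra.
have sE : s * (r + 2) = 2 * c * (r - 1).
  by apply: (mulfI cN0); move: dE; rewrite ds; lra.
have c0 : 0 <= c by lra.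
have rc : 3 * c <= r * c by exact: ler_wpM2r.
have s_ge : 4 * c <= 5 * s.
  by rewrite -(ler_pM2r (_ : 0 < r + 2)); lra.
have s_lt : s < 2 * c by rewrite -(ltr_pM2r (_ : 0 < r + 2)); lra.
have d_ge0 : 0 <= d by lra.
have rs : 3 * s <= r * s by apply: ler_wpM2r; [lra|].
have lapE : clique_lap_energy d (r * c) + clique_lap_energy d c
    + clique_lap_energy d c = 2 * (r * c - 1) * (1 + s).
  rewrite /clique_lap_energy (ger0_norm d_ge0).
  have -> : r * c - d = 1 + s by rewrite ds; ring.
  have -> : c - d = 1 - r * s / 2 by rewrite ds; lra.
  rewrite ger0_norm; last lra.
  rewrite ler0_norm; last lra.
  by rewrite ds; lra.
have enE : clique_energy (r * c) + clique_energy c + clique_energy c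
    = 2 * (r * c - 1) + 4 * (c - 1).
  by rewrite /clique_energy !ger0_norm; lra.
have slapE : clique_slap_energy d (r * c) + clique_slap_energy d c
    + clique_slap_energy d c
    = (r * c - 1) * `|s - 1| + (r * c - 1 + s)
      + 2 * ((c - 1) * (r * s / 2 + 1) + (r * s / 2 + 1 - c)).
  rewrite /clique_slap_energy.
  have -> : r * c - 2 - d = s - 1 by rewrite ds; ring.
  have -> : 2 * (r * c) - 2 - d = r * c - 1 + s by rewrite ds; ring.
  have -> : c - 2 - d = - (r * s / 2 + 1) by rewrite ds; lra.
  have -> : 2 * c - 2 - d = - (r * s / 2 + 1 - c) by rewrite ds; lra.
  rewrite !normrN (ger0_norm (_ : 0 <= r * c - 1 + s)); last lra.
  rewrite (ger0_norm (_ : 0 <= r * s / 2 + 1)); last lra.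
  by rewrite (ger0_norm (_ : 0 <= r * s / 2 + 1 - c)); lra.
have prod_ge : 0 <= (r * c - 2) * s by apply: mulr_ge0; lra.
rewrite lapE enE slapE; split; first nra.
by have [s1|s1] := leP 0 (s - 1); rewrite ?(ger0_norm s1) ?(ltr0_norm s1); nra.
Qed.

(** These are the cliques of CCC(D_14): the average degree is 3/2, the Laplacian energy 6 and the
    signless one 5. *)
Lemma cliques_3_1_energies : d * (3 + 1) = 3 * (3 - 1) + 1 * (1 - 1) ->
  clique_slap_energy d 3 + clique_slap_energy d 1
  < clique_lap_energy d 3 + clique_lap_energy d 1.
Proof.
rewrite /clique_lap_energy /clique_slap_energy => dE.
have -> : d = 3 / 2 by lra.
rewrite subrr !mul0r !add0r !(ger0_norm (_ : 0 <= 3 / 2)); [|lra..].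
rewrite (ger0_norm (_ : 0 <= 3 - 3 / 2)); [|lra].
rewrite (ler0_norm (_ : 3 - 2 - 3 / 2 <= 0)); [|lra].
rewrite (ger0_norm (_ : 0 <= 2 * 3 - 2 - 3 / 2)); [|lra].
by rewrite ler0_norm; lra.
Qed.

End CliqueEnergyComparison.

Section ProfileEnergies.

Variables (n : 'I_3 -> nat) (z c : nat).

(* [n] lists the clique sizes of CCC(G) for [z = |Z(G)|] and [c = |W|]: the
   clique inside A, then the one or two outside ([n 2 = 0] when [c] is odd). *)
Definition ccc_profile :=
  [/\ (0 < z)%N, (1 < c)%N, (2 * n 0%R = z * c.-1)%N,
      ((~~ odd c).+1 * n 1%R = z)%N & (n 1%R + n 2%R = z)%N].

Lemma sum_ord3 (V : nmodType) (F : 'I_3 -> V) : \sum_i F i = F 0 + F 1 + F 2.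
Proof.
rewrite !big_ord_recl big_ord0 addr0 addrA.
by congr (F _ + F _ + F _); apply: val_inj.
Qed.

Lemma cliques_degree3 (a b b' : nat) : n 0 = a -> n 1 = b -> n 2 = b' ->
  (0 < b)%N -> cliques_degree n * (a%:R + b%:R + b'%:R)
  = a%:R * (a%:R - 1) + b%:R * (b%:R - 1) + b'%:R * (b'%:R - 1).
Proof.
move=> <- <- <- n1; rewrite /cliques_degree !sum_ord3 divfK //.
by rewrite -!natrD pnatr_eq0; lia.
Qed.

(** For [c = 2r + 1] the sizes are rz, z, 0; for even [c] and z = 2h they are (c - 1)h, h, h. Thus
    [c = 2] and [c = 3] give equal cliques, while [c = 5], [z = 1] gives sizes 2 and 1. *)
Lemma ccc_profile_energies : ccc_profile ->
  [/\ cliques_energy n <= cliques_lap_energy n,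
      cliques_slap_energy n <= cliques_lap_energy n &
      (c <= 3)%N \/ c = 5 /\ z = 1%N ->
      cliques_lap_energy n = cliques_slap_energy n].
Proof.
case=> z0 c1 n0E n1E n2E.
rewrite /cliques_energy /cliques_lap_energy /cliques_slap_energy !sum_ord3.
case c_odd: (odd c); rewrite c_odd in n1E.
  pose r := c./2.
  have cE : c = (2 * r).+1 by rewrite /r; lia.
  have n1 : n 1 = z by lia.
  have n2 : n 2 = 0%N by lia.
  have n0 : n 0 = (r * z)%N by move: n0E; rewrite cE; lia.
  have r0 : (0 < r)%N by lia.
  have := cliques_degree3 n0 n1 n2 z0; rewrite n0 n1 n2.
  move: (cliques_degree n) => d; rewrite natrM => dE.
  rewrite mul0r !addr0 in dE.
  rewrite clique_energy0 clique_lap_energy0 clique_slap_energy0 !addr0.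
  have z1' : 1 <= z%:R :> rat by rewrite ler1n.
  have [r1|r2] : r = 1%N \/ (2 <= r)%N by lia.
    rewrite r1 !mul1r in dE *.
    have [] := equal_cliques_energies (two_equal_cliques_degree z1' dE).
    by move=> -> ->; split.
  have r2' : 2 <= r%:R :> rat by rewrite ler_nat.
  have z12 : z%:R = 1 :> rat \/ 2 <= z%:R :> rat.
    by rewrite !ler_nat; case: (z) z0 => [|[|m]] // _; [left|right].
  have [en_le slap_le eq2] := two_cliques_energies z1' r2' z12 dE.
  split=> // -[|[c5 z1]]; first lia.
  by rewrite eq2 // ?z1 //; have -> : r = 2%N by lia.
pose r := c.-1; pose h := n 1.
have zE : z = (2 * h)%N by rewrite /h; lia.
have n1 : n 1 = h by [].
have n2 : n 2 = h by lia.
have n0 : n 0 = (r * h)%N by rewrite /r; move: n0E; rewrite zE; lia.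
have h0 : (0 < h)%N by lia.
have := cliques_degree3 n0 n1 n2 h0; rewrite n0 n1 n2.
move: (cliques_degree n) => d; rewrite natrM => dE.
have h1' : 1 <= h%:R :> rat by rewrite ler1n.
(* As [c] is even, [r] is odd, which excludes 2. *)
have [r1|r3] : r = 1%N \/ (3 <= r)%N by rewrite /r; lia.
  rewrite r1 !mul1r in dE *.
  have [] := equal_cliques_energies (three_equal_cliques_degree h1' dE).
  by move=> -> ->; split.
have r3' : 3 <= r%:R :> rat by rewrite ler_nat.
have [en_le slap_le] := three_cliques_energies h1' r3' dE.
split=> // -[|[c5 _]]; first by rewrite /r in r3; lia.
by rewrite c5 in c_odd.
Qed.

Lemma ccc_profile_7 : ccc_profile -> c = 7 -> z = 1%N ->
  cliques_slap_energy n < cliques_lap_energy n.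
Proof.
case=> _ _ n0E n1E n2E c7 z1; rewrite z1 c7 in n0E n1E n2E.
have n0 : n 0 = 3 by lia.
have n1 : n 1 = 1%N by lia.
have n2 : n 2 = 0%N by lia.
have := cliques_degree3 n0 n1 n2 isT.
rewrite /cliques_slap_energy /cliques_lap_energy !sum_ord3 n0 n1 n2.
move: (cliques_degree n) => d; rewrite mul0r !addr0 => /cliques_3_1_energies.
by rewrite clique_lap_energy0 clique_slap_energy0 !addr0.
Qed.

End ProfileEnergies.

Local Close Scope ring_scope.
Local Open Scope group_scope.

(** * Groups with an abelian subgroup of index two *)

Lemma index2_setU (gT : finGroupType) (H K : {group gT}) u :
  K \subset H -> #|H : K| = 2 -> u \in H -> u \notin K ->
  H :=: K :|: u *: K.
Proof.
move=> sKH iK uH uK; apply/esym/eqP; rewrite eqEcard; apply/andP; split.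
  by rewrite subUset sKH mul_subG ?sub1set.
rewrite cardsU card_lcoset -(Lagrange sKH) iK muln2 -addnn.
suff -> : K :&: u *: K = set0 by rewrite cards0 subn0.
apply/eqP; rewrite -subset0; apply/subsetP=> x /setIP[xK].
rewrite mem_lcoset => uxK; case/negP: uK.
by move: uxK; rewrite groupMr // groupV.
Qed.

Lemma index2_mulVg (gT : finGroupType) (H K : {group gT}) u v :
  K \subset H -> #|H : K| = 2 -> u \in H -> u \notin K -> v \in H ->
  v \notin K -> u^-1 * v \in K.
Proof.
move=> sKH iK uH uK + /negPf vK; rewrite (index2_setU sKH iK uH uK).
by rewrite inE vK /= mem_lcoset.
Qed.

Lemma card_class_uniform (gT : finGroupType) (G : {group gT}) (S : {set gT}) m :
  {in S & G, forall x g, x ^ g \in S} -> {in S, forall x, #|x ^: G| = m} ->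
  #|S| = (#|[set x ^: G | x in S]| * m)%N.
Proof.
move=> SG Sm.
have actS : [acts G, on S | 'J].
  by apply/actsP => g gG x; apply/idP/idP => [/SG/(_ (groupVr gG))|xS];
    rewrite /= ?conjgK //; apply: SG.
apply: (card_uniform_partition _ (orbit_partition actS)).
by move=> _ /imsetP[x xS ->]; rewrite orbitJ Sm.
Qed.

Lemma noncentral_conj (gT : finGroupType) (G : {group gT}) :
  {in G :\: 'Z(G) & G, forall x g, x ^ g \in G :\: 'Z(G)}.
Proof.
move=> x g /setDP[xG xZ] gG; apply/setDP; split; first exact: groupJ.
by rewrite memJ_norm // (subsetP (normal_norm (center_normal G))).
Qed.

Section AbelianIndexTwo.

Variables (gT : finGroupType) (G A : {group gT}) (t : gT).
Hypotheses (sAG : A \subset G) (abA : abelian A) (iA : #|G : A| = 2).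
Hypotheses (tG : t \in G) (tA : t \notin A) (nabG : ~~ abelian G).

Let nAG : A <| G. Proof. exact: index2_normal. Qed.
Let A_conj x g : x \in A -> g \in G -> x ^ g \in A.
Proof. by move=> xA gG; rewrite memJ_norm // (subsetP (normal_norm nAG)). Qed.
Let A_conjE x y : x \in A -> y \in A -> x ^ y = x.
Proof. by move=> xA yA; apply/conjg_fixP/commgP/(centsP abA). Qed.

(** [A] and [u] generate [G], so [G] would be abelian if [u] centralized [A]. *)
Lemma outside_not_central u : u \in G -> u \notin A -> ~~ (A \subset 'C[u]).
Proof.
move=> uG uA; apply: contra nabG => Au.
have -> : G :=: A <*> <[u]>.
  apply/eqP; rewrite eqEsubset join_subG sAG cycle_subG uG !andbT.
  rewrite {1}(index2_setU sAG iA uG uA) subUset joing_subl /=.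
  by rewrite mul_subG ?joing_subl // sub1set mem_gen // inE cycle_id orbT.
by rewrite abelianY abA cycle_abelian centsC cent_cycle.
Qed.

Lemma centerE : 'Z(G) = 'C_A[t].
Proof.
apply/setP=> z; rewrite 2!inE; apply/andP/andP => [[zG zC]|[zA zt]].
  split; last by apply/cent1P; apply: (centP zC).
  apply: contraT => zA; case/negP: (outside_not_central zG zA).
  by apply/subsetP=> a aA; apply/cent1P/commute_sym/(centP zC)/(subsetP sAG).
split; first exact: (subsetP sAG).
apply/centP => g; rewrite (index2_setU sAG iA tG tA) => /setUP[gA|].
  exact: (centsP abA).
case/lcosetP=> a aA ->; apply: commuteM; first exact/cent1P.
exact: (centsP abA).
Qed.

Lemma center_sub : 'Z(G) \subset A.
Proof. by rewrite centerE subsetIl. Qed.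

Lemma commg_in a : a \in A -> [~ t, a] \in A.
Proof.
by move=> aA; rewrite commgEr groupM // A_conj ?groupV.
Qed.

(** In the commutator identity for a product, the conjugation by [b] is trivial on the abelian [A].
    The kernel of this morphism is Z(G), which yields |Z(G)| |W| = |A|. *)
Lemma comm_morphM : {in A &, {morph (fun a => [~ t, a]) : a b / a * b}}.
Proof.
move=> a b aA bA /=; rewrite commgMJ (A_conjE (commg_in aA) bA).
exact: (centsP abA _ (commg_in bA) _ (commg_in aA)).
Qed.

Canonical comm_morphism := Morphism comm_morphM.

Let W := (comm_morphism @* A)%G.

Lemma comm_image_sub : W \subset A.
Proof.
by apply/subsetP=> _ /morphimP[a _ aA ->]; apply: commg_in.
Qed.

Lemma card_comm_image : (#|'Z(G)| * #|W| = #|A|)%N.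
Proof.
have -> : 'Z(G) = 'ker comm_morphism.
  rewrite centerE; apply/setP=> a; apply/setIP/idP => [[aA /cent1P ta]|ka].
    by apply/kerP => //; apply/eqP/commgP/commute_sym.
  have aA := dom_ker ka; split=> //; apply/cent1P/commute_sym/commgP/eqP.
  exact: (kerP _ aA ka).
by rewrite card_morphim setIid Lagrange // subsetIl.
Qed.

(** Writing u = tb with b in [A] gives [u, a] = [t, a], so conjugation by [A] sweeps out the coset.
    A conjugator g outside [A] acts on [u] as [u^-1 * g], which lies in [A]. *)
Lemma class_outside u : u \in G -> u \notin A -> u ^: G = u *: W.
Proof.
move=> uG uA.
have conj_a a : a \in A -> u ^ a = u * [~ t, a].
  move=> aA; rewrite conjg_mulR; congr (_ * _).
  have := index2_mulVg sAG iA tG tA uG uA; set b := _ * u => bA.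
  have -> : u = t * b by rewrite mulKVg.
  rewrite commMgJ (A_conjE (commg_in aA) bA).
  have /commgP/eqP-> : commute b a by exact: (centsP abA).
  by rewrite mulg1.
apply/setP=> v; apply/imsetP/lcosetP => [[g gG ->]|[_ /morphimP[a _ aA ->] ->]].
  have [gA|gA] := boolP (g \in A).
    by exists [~ t, g]; rewrite ?conj_a //; apply: mem_morphim.
  have aA := index2_mulVg sAG iA uG uA gG gA.
  exists [~ t, u^-1 * g]; first exact: mem_morphim.
  by rewrite -(conj_a _ aA) conjgM [u ^ u^-1]conjgE mulgV invgK mulg1.
by exists a; rewrite ?conj_a //; apply: (subsetP sAG).
Qed.

Lemma commute_outside_central a u :
  a \in A -> u \in G -> u \notin A -> commute a u -> a \in 'Z(G).
Proof.
move=> aA uG uA au; rewrite inE (subsetP sAG) //; apply/centP=> g.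
rewrite (index2_setU sAG iA uG uA) inE => /orP[gA|/lcosetP[b bA ->]].
  exact: (centsP abA).
by apply: commuteM; last exact: (centsP abA).
Qed.

(** The centralizer of [a] in [G] is exactly [A]. *)
Lemma card_class_inside a : a \in A -> a \notin 'Z(G) -> #|a ^: G| = 2.
Proof.
move=> aA aZ; rewrite -index_cent1 -iA; congr #|_ : _|.
apply/eqP; rewrite eqEsubset subsetI sAG /= andbC; apply/andP; split.
  by apply/subsetP=> b bA; apply/cent1P/(centsP abA).
apply/subsetP=> u /setIP[uG /cent1P ua]; apply: contraR aZ => uA.
by apply: commute_outside_central uG uA _ => //; apply: commute_sym.
Qed.

Lemma comm_image_gt1 : 1 < #|W|.
Proof.
rewrite ltnNge; apply: contra (outside_not_central tG tA) => W1.
have {}W1 : W :=: 1 by exact: card_le1_trivg.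
apply/subsetP=> a aA; apply/cent1P/commute_sym/commgP.
rewrite -in_set1 -set1gE -W1.
exact: mem_morphim.
Qed.

(** [t, a] is the product of the inverse of [a ^ t] and [a]. Since t^2 lies in the abelian [A],
    conjugation by [t] swaps [a] and [a ^ t]. *)
Lemma conj_comm_image v : v \in W -> v ^ t = v^-1.
Proof.
case/morphimP=> a _ aA -> /=.
have ttA : t * t \in A.
  have tV : t^-1 \notin A by rewrite groupV.
  by rewrite -{1}[t]invgK; apply: (index2_mulVg sAG iA); rewrite ?groupV.
rewrite conjRg [t ^ t]conjgE mulKg commgEr -conjVg -conjgM.
by rewrite (A_conjE (groupVr aA) ttA) -commgEl invg_comm.
Qed.

Hypothesis cycW : cyclic W.

(** As [t] inverts [W], the central elements of [W] are those of square 1. In a cyclic group they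
    form a subgroup of order 1 or 2, and Cauchy's theorem provides an involution when the order is
    even. *)
Lemma card_center_comm_image : #|'Z(G) :&: W| = (~~ odd #|W|).+1.
Proof.
have ZWE v : v \in W -> (v \in 'Z(G)) = (v ^+ 2 == 1).
  move=> vW; have vA := subsetP comm_image_sub _ vW.
  have vE : (v ^+ 2 == 1) = (v ^ t == v).
    by rewrite conj_comm_image // eq_invg_mul.
  rewrite vE centerE inE vA; apply/cent1P/eqP => [tv|/conjg_fixP/commgP//].
  by apply/conjg_fixP/commgP/commute_sym.
have /cyclicP[v vE] : cyclic ('Z(G) :&: W).
  by apply: cyclicS cycW; apply: subsetIr.
have /setIP[vZ vW] : v \in 'Z(G) :&: W by rewrite vE cycle_id.
have v2 : #[v] %| 2 by rewrite order_dvdn -ZWE.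
have -> : #|'Z(G) :&: W| = #[v] by rewrite vE.
have vcard : #[v] %| #|W| by apply: order_dvdG.
have [c_odd|c_even] /= := boolP (odd #|W|).
  apply/eqP; rewrite -dvdn1 -(eqP (_ : coprime 2 #|W|)) ?dvdn_gcd ?v2 //.
  by rewrite coprime2n.
have [|w wW w2] := @Cauchy _ 2 W isT; first by rewrite dvdn2.
apply/eqP; rewrite eqn_dvd v2 /= -w2 [#[v]]orderE -vE order_dvdG //.
by rewrite inE wW ZWE // -w2 expg_order eqxx.
Qed.

Let H := ('Z(G) <*> W)%G.

Let HE : H :=: 'Z(G) * W.
Proof.
apply: cent_joinEr; apply: centSS abA; first exact: comm_image_sub.
exact: center_sub.
Qed.

Let H_sub : H \subset A.
Proof. by rewrite HE mul_subG ?center_sub ?comm_image_sub. Qed.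

Let card_H : (#|H| * (~~ odd #|W|).+1 = #|A|)%N.
Proof. by rewrite -card_center_comm_image HE -mul_cardG card_comm_image. Qed.

(* Inside A, or one of the at most two cosets of Z(G) * W outside A. *)
Let label x : 'I_3 :=
  if x \in A then 0%R else if x \in t *: H then 1%R else 2%R.

Let label_in x : (label x == 0%R) = (x \in A).
Proof.
by rewrite /label; case: ifP => // _; case: ifP.
Qed.

Let label_class x g : x \in G -> g \in G -> label (x ^ g) = label x.
Proof.
move=> xG gG; rewrite /label memJ_norm ?(subsetP (normal_norm nAG)) //.
case: ifPn => // xA; have : x ^ g \in x ^: G by apply: memJ_class.
rewrite class_outside // => /lcosetP[v vW ->].
by rewrite !mem_lcoset mulgA groupMr //; apply: (subsetP (joing_subr _ _)).
Qed.

(** If [x] and [y] lie outside [A], then [x^-1 * y] lies in [A] and commutes with [x], hence is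
    central; so both are in one coset of [H]. *)
Let label_commute x y : x \in G :\: 'Z(G) -> y \in G :\: 'Z(G) ->
  commute x y -> label x = label y.
Proof.
case/setDP=> xG xZ /setDP[yG yZ] xy; rewrite /label.
have [xA|xA] := boolP (x \in A); have [yA|yA] := boolP (y \in A) => //.
- by case/negP: xZ; exact: commute_outside_central xA yG yA xy.
- by case/negP: yZ; exact: commute_outside_central yA xG xA (commute_sym xy).
have xyZ : x^-1 * y \in 'Z(G).
  have xyA := index2_mulVg sAG iA xG xA yG yA.
  apply: (commute_outside_central xyA xG xA); apply: commute_sym.
  by apply: commuteM => //; apply: commuteV.
have xyH : x^-1 * y \in H by apply: (subsetP (joing_subl _ _)) xyZ.
by rewrite !mem_lcoset -[y in RHS](mulKVg x) mulgA (groupMr _ xyH).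
Qed.

(** Outside [A], equal labels give y = xzv with z central and v in [W]. Then [y * v^-1] is a
    conjugate of [y] equal to xz. *)
Let commute_label x y : x \in G -> y \in G -> label x = label y ->
  exists2 y', y' \in y ^: G & commute x y'.
Proof.
move=> xG yG xy; have := label_in y; rewrite -xy label_in.
have [xA|xA] := boolP (x \in A) => /esym yA.
  by exists y; [exact: class_refl | apply: (centsP abA)].
have {}yA : y \notin A by rewrite yA.
have : x^-1 * y \in H.
  have txA := index2_mulVg sAG iA tG tA xG xA.
  have tyA := index2_mulVg sAG iA tG tA yG yA.
  have -> : x^-1 * y = (t^-1 * x)^-1 * (t^-1 * y).
    by rewrite invMg invgK mulgA mulgK.
  move: xy; rewrite /label (negPf xA) (negPf yA) !mem_lcoset.
  have [txH|txH] := boolP (_ * x \in H); have [tyH|tyH] := boolP (_ * y \in H).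
  - by rewrite groupM ?groupV.
  - by move/(congr1 val).
  - by move/(congr1 val).
  (* An element of [A] outside [H] exists, so [H] has index 2 and two such elements differ by an
     element of [H]. *)
  move=> _; apply: (index2_mulVg H_sub) => //.
  apply/eqP; rewrite -(eqn_pmul2l (cardG_gt0 H)) Lagrange // -card_H.
  rewrite eqn_pmul2l //; case c_odd: (odd _) card_H => //; rewrite muln1 => HA.
  case/negP: txH; rewrite (_ : H :=: A) //.
  by apply/eqP; rewrite eqEcard H_sub HA /=.
rewrite HE => /mulsgP[z v zZ vW xyE].
exists (y * v^-1).
  by rewrite class_outside // mem_lcoset mulKg groupV.
rewrite -[y](mulKVg x) xyE -mulgA mulgK; apply: commuteM => //.
by have /setIP[_ /centP zC] := zZ; apply/commute_sym/zC.
Qed.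

Definition ccc_label (X : CCC G) : 'I_3 := label (repr (val X)).

Let ccc_labelE (X : CCC G) x : x \in val X -> ccc_label X = label x.
Proof.
case: X => X XG /=; rewrite /ccc_label /=; case/imsetP: XG => y /setDP[yG _] ->.
have /imsetP[g gG ->] := mem_repr _ (class_refl G y).
by case/imsetP=> h hG ->; rewrite !label_class.
Qed.

Lemma ccc_label_clique_union : clique_union ccc_label.
Proof.
case=> [X XG] [Y YG]; rewrite /= /ccc_adj /=; congr (_ && _).
have /imsetP[x xGZ XE] := XG; have /imsetP[y yGZ YE] := YG.
have [xG yG] : x \in G /\ y \in G by case/setDP: xGZ; case/setDP: yGZ.
rewrite (@ccc_labelE _ x) ?(@ccc_labelE _ y) /= ?XE ?YE ?class_refl //.
apply/exists_inP/eqP => [[_ /imsetP[g gG ->]]|].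
  case/exists_inP=> _ /imsetP[h hG ->] /eqP xy.
  rewrite -(label_class xG gG) -(label_class yG hG); apply: label_commute xy.
    exact: noncentral_conj.
  exact: noncentral_conj.
case/(commute_label xG yG) => y' y'Y xy'; exists x; first exact: class_refl.
by apply/exists_inP; exists y' => //; apply/eqP.
Qed.

Let card_label (i : 'I_3) m :
  {in G :\: 'Z(G), forall x, label x = i -> #|x ^: G| = m} ->
  #|[set x in G :\: 'Z(G) | label x == i]| = (class_size ccc_label i * m)%N.
Proof.
move=> im; rewrite (@card_class_uniform _ G _ m).
- congr (_ * _)%N; rewrite /class_size -[RHS](card_imset _ val_inj).
  apply: eq_card => X; apply/imsetP/imsetP => [[x]|[Y]].
    rewrite inE => /andP[xGZ /eqP xi] ->.
    have XG : x ^: G \in noncentral_classes G by apply: imset_f.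
    exists (Sub (x ^: G) XG) => //.
    by rewrite inE (@ccc_labelE _ x) ?xi //= class_refl.
  rewrite inE => /eqP Yi ->; have /imsetP[x xGZ xY] := valP Y.
  exists x => //; rewrite inE xGZ -Yi (@ccc_labelE _ x) ?eqxx //.
  by rewrite xY class_refl.
- move=> x g; rewrite inE => /andP[xGZ xi] gG.
  by rewrite inE noncentral_conj //= label_class //; case/setDP: xGZ.
by move=> x; rewrite inE => /andP[xGZ /eqP]; apply: im.
Qed.

Let mem_tA x : (x \in t *: A) = (x \in G) && (x \notin A).
Proof.
rewrite (index2_setU sAG iA tG tA) inE; have [xA|] /= := boolP (x \in A).
  by rewrite mem_lcoset groupMr // groupV (negPf tA).
by rewrite andbT.
Qed.

Let outsideE x : (x \in G :\: 'Z(G)) && (x \notin A) = (x \in t *: A).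
Proof.
rewrite mem_tA inE; have [//|xA] := boolP (x \in A); rewrite ?andbF //.
by rewrite (contra (subsetP center_sub x) xA) !andbT.
Qed.

(** The labels 0, 1, 2 are carried by |A| - |Z(G)|, |H| and |A| - |H| noncentral elements, in
    classes of sizes 2, |W| and |W|. *)
Lemma ccc_label_profile :
  ccc_profile (class_size ccc_label) #|'Z(G)| #|W|.
Proof.
have n0 : (#|A| - #|'Z(G)| = class_size ccc_label 0%R * 2)%N.
  rewrite -(card_label (i := 0%R)); last first.
    move=> x /setDP[_ xZ] /eqP; rewrite label_in => xA.
    exact: card_class_inside.
  rewrite -(setIidPr center_sub) -cardsD; apply: eq_card => x.
  rewrite !inE label_in; case: (boolP (x \in A)) => xA;
    rewrite ?andbT ?andbF //.
  by rewrite (subsetP sAG _ xA) andbT.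
have class_out x : x \in G :\: 'Z(G) -> label x != 0%R -> #|x ^: G| = #|W|.
  by case/setDP=> xG _; rewrite label_in => xA;
    rewrite class_outside // card_lcoset.
have n1 : (#|H| = class_size ccc_label 1%R * #|W|)%N.
  rewrite -(card_label (i := 1%R)); last first.
    by move=> x xGZ x1; apply: class_out; rewrite ?x1.
  rewrite -(card_lcoset H t); apply: eq_card => x.
  rewrite [RHS]inE.
  have -> : (label x == 1%R) = (x \notin A) && (x \in t *: H).
    by rewrite /label; case: (x \in A) => //=; case: ifP.
  rewrite andbA outsideE.
  apply/idP/andP => [xH|[]//]; split=> //.
  by apply: (subsetP (mulgS _ H_sub)) xH.
have n2 : (#|A| - #|H| = class_size ccc_label 2%R * #|W|)%N.
  rewrite -(card_label (i := 2%R)); last first.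
    by move=> x xGZ x2; apply: class_out; rewrite ?x2.
  rewrite -(setIidPr H_sub) -cardsD -(card_lcoset _ t); apply: eq_card => x.
  rewrite [RHS]inE.
  have -> : (label x == 2%R) = (x \notin A) && (x \notin t *: H).
    by rewrite /label; case: (x \in A) => //=; case: ifP.
  by rewrite andbA outsideE !mem_lcoset inE andbC.
have c1 := comm_image_gt1; have z0 : 0 < #|'Z(G)| by apply: cardG_gt0.
have k0 : 0 < (~~ odd #|W|).+1 by [].
move: card_comm_image card_H n0 n1 n2 c1 z0 k0; rewrite /ccc_profile.
move: (class_size _ 0%R) (class_size _ 1%R) (class_size _ 2%R) => n0 n1 n2.
move: #|'Z(G)| #|W| (~~ odd _).+1 #|A| #|H| => z c k a h.
move=> <- hk n0E n1E n2E c1 z0 k0; split=> //.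
- nia.
- nia.
nia.
Qed.

End AbelianIndexTwo.

(* Here A is generated by [x] and [s], and W by [[~ t, x]]; the central element
   [s] is needed only for U_(n,m) and V_8n. *)
Definition inverting_generators (gT : finGroupType) (G : {group gT}) x s t :=
  [/\ <[x]> <*> <[s]> <*> <[t]> = G, commute x s, commute s t,
      x ^ t \in <[x]> <*> <[s]> & t ^+ 2 \in <[x]> <*> <[s]>].

(** [t] normalizes [A] and its square lies in [A], while [t] in [A] would make [G] abelian; hence
    the index is 2. As [t, s] = 1, [W] is generated by [t, x]. *)
Lemma inverting_generators_profile (gT : finGroupType) (G : {group gT}) x s t :
  inverting_generators G x s t -> ~~ abelian G ->
  exists (f : CCC G -> 'I_3) z,
    [/\ clique_union f, ccc_profile (class_size f) z #[[~ t, x]]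
      & (z * #[[~ t, x]] = #|<[x]> <*> <[s]>|)%N].
Proof.
case=> GE xs st xt t2 nabG.
pose A := (<[x]> <*> <[s]>)%G.
have [xA sA] : x \in A /\ s \in A.
  by rewrite !mem_gen // inE cycle_id ?orbT.
have abA : abelian A.
  rewrite abelianY !cycle_abelian cent_cycle cycle_subG.
  exact/cent1P/commute_sym.
have tA : t \notin A.
  apply: contra nabG => tA; suff -> : G :=: A by [].
  by rewrite -GE; apply/joing_idPl; rewrite cycle_subG.
have nAt : t \in 'N(A).
  rewrite inE -[A :^ t]/((<[x]> <*> <[s]>) :^ t) conjYg -!cycleJ join_subG.
  rewrite !cycle_subG xt /= (_ : s ^ t = s) //.
  exact/conjg_fixP/commgP.
have sAG : A \subset G by rewrite -GE joing_subl.
have tG : t \in G by rewrite -GE mem_gen // inE cycle_id orbT.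
have iA : #|G : A| = 2.
  have nAG : G \subset 'N(A) by rewrite -GE join_subG normG cycle_subG.
  rewrite -card_quotient // -GE quotientYidl ?cycle_subG // quotient_cycle //.
  have tN1 : #[coset A t] != 1%N.
    by rewrite order_eq1; apply: contra tA => /eqP; apply: coset_idr.
  have tdvd : #[coset A t] %| 2 by rewrite order_dvdn -morphX //= coset_id.
  exact/(prime_nt_dvdP _ tN1).
have WE : comm_morphism sAG abA iA tG @* A = <[ [~ t, x] ]>.
  rewrite morphimY ?cycle_subG // !morphim_cycle //=.
  have -> : [~ t, s] = 1 by apply/eqP/commgP/commute_sym.
  by rewrite cycle1 joingG1.
have cycW : cyclic (comm_morphism sAG abA iA tG @* A).
  by rewrite WE cycle_cyclic.
exists (ccc_label sAG abA iA tG), #|'Z(G)|; split.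
- exact: (ccc_label_clique_union tA nabG cycW).
- have := @ccc_label_profile _ _ _ _ sAG abA iA tG tA nabG cycW.
  by rewrite /= WE.
by have := @card_comm_image _ _ _ _ sAG abA iA tG tA nabG; rewrite /= WE.
Qed.

(** * The five families *)

(** The graph has no vertices, as happens for U_(n,2), and empty cliques contribute 0. *)
Lemma ccc_abelian_energies (C : numClosedFieldType) (gT : finGroupType)
    (G : {group gT}) : abelian G ->
  [/\ energy C (CCC G) = 0, lap_energy C (CCC G) = 0
    & slap_energy C (CCC G) = 0]%R.
Proof.
move=> abG.
have noX (X : CCC G) : False.
  have /imsetP[x /setDP[xG]] := valP X.
  by rewrite inE xG (subsetP abG).
pose f (X : CCC G) : 'I_3 := 0%R.
have fE : clique_union f by move=> X; case: (noX X).
have f0 i : class_size f i = 0 by apply: eq_card0 => X; case: (noX X).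
rewrite (energy_clique_union C fE) (lap_energy_clique_union C fE).
rewrite (slap_energy_clique_union C fE).
rewrite /cliques_energy /cliques_lap_energy /cliques_slap_energy.
by split; rewrite big1 ?rmorph0 // => i _; rewrite f0
  ?clique_energy0 ?clique_lap_energy0 ?clique_slap_energy0.
Qed.

(** Since z times the order of [t, x] is |A|, order 5 and |A| at most 5 force z = 1. *)
Lemma inverting_generators_energies (C : numClosedFieldType)
    (gT : finGroupType) (G : {group gT}) x s t :
  inverting_generators G x s t ->
  [/\ (energy C (CCC G) <= lap_energy C (CCC G))%R,
      (slap_energy C (CCC G) <= lap_energy C (CCC G))%R &
      #[[~ t, x]] <= 3 \/ #[[~ t, x]] = 5 /\ #|<[x]> <*> <[s]>| <= 5 ->
      lap_energy C (CCC G) = slap_energy C (CCC G)].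
Proof.
move=> genG; have [abG|nabG] := boolP (abelian G).
  by have [-> -> ->] := ccc_abelian_energies C abG.
have [f [z [fE fz zc]]] := inverting_generators_profile genG nabG.
have [en_le slap_le lapE] := ccc_profile_energies fz.
rewrite (energy_clique_union C fE) (lap_energy_clique_union C fE).
rewrite (slap_energy_clique_union C fE) !ler_rat; split=> // c_small.
rewrite lapE //; case: c_small => [|[c5 A5]]; [by left | right; split=> //].
by rewrite -zc c5 in A5; case: fz => z0 _ _ _ _; lia.
Qed.

Lemma commg_conj (gT : finGroupType) (x t : gT) : [~ t, x] = (x ^ t)^-1 * x.
Proof. by rewrite commgEr conjVg. Qed.

Lemma cycleX_joing (gT : finGroupType) (x : gT) k :
  <[x ^+ k]> <*> <[x]> = <[x]>.
Proof. by apply/joing_idPr; apply: cycleX. Qed.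

Lemma is_D_generators n (gT : finGroupType) (G : {group gT}) : is_D n G ->
  exists x t, [/\ inverting_generators G x 1 t, x ^+ n = 1, t ^+ 2 = 1
                & [~ t, x] = x ^+ 2].
Proof.
move/isoGrp_hom/existsP=> [[x y] /=] /eqP[GE xn y2 yxy].
have xy : x ^ y = x^-1.
  rewrite -yxy conjgE -mulgA; congr (_ * _).
  by apply/eqP; rewrite eq_invg_mul -y2.
exists x, y; rewrite commg_conj xy invgK; split=> //; split=> //.
- by rewrite cycle1 joingG1.
- exact: commute1.
- exact: commute_sym (commute1 _).
- by rewrite xy groupV mem_gen // inE cycle_id.
by rewrite y2.
Qed.

Lemma is_Q_generators m (gT : finGroupType) (G : {group gT}) : is_Q m G ->
  exists x t, [/\ inverting_generators G x 1 t, x ^+ (2 * m) = 1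
                & [~ t, x] = x ^+ 2].
Proof.
move/isoGrp_hom/existsP=> [[x y] /=] /eqP[GE xn xm yxy].
have xy : x ^ y = x^-1 by rewrite -yxy conjgE mulgA.
exists x, y; rewrite commg_conj xy invgK; split=> //; split=> //.
- by rewrite cycle1 joingG1.
- exact: commute1.
- exact: commute_sym (commute1 _).
- by rewrite xy groupV mem_gen // inE cycle_id.
by rewrite -xm mem_gen // inE mem_cycle.
Qed.

(** The roles are exchanged: the presentation's [x] inverts [y], and its square, which commutes with
    [y], serves as [s]. *)
Lemma is_U_generators n m (gT : finGroupType) (G : {group gT}) : is_U n m G ->
  exists x s t, [/\ inverting_generators G x s t, x ^+ m = 1
                  & [~ t, x] = x ^+ 2].
Proof.
move/isoGrp_hom/existsP=> [[x y] /=] /eqP[GE xn ym xyx].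
have yx : y ^ x = y^-1 by rewrite -xyx conjgE mulgA.
exists y, (x ^+ 2), x; rewrite commg_conj yx invgK; split=> //; split=> //.
- by rewrite -joingA cycleX_joing joingC.
- by apply/commgP/conjg_fixP; rewrite conjgM yx conjVg yx invgK.
- exact/commute_sym/commuteX.
- by rewrite yx groupV mem_gen // inE cycle_id.
by rewrite mem_gen // inE cycle_id orbT.
Qed.

Lemma is_V_generators n (gT : finGroupType) (G : {group gT}) : is_V n G ->
  exists x s t, [/\ inverting_generators G x s t, x ^+ (2 * n) = 1, s ^+ 2 = 1,
                    commute x s & [~ t, x] = s^-1 * x ^+ 2].
Proof.
move/isoGrp_hom/existsP=> [[x y] /=] /eqP[GE xn y4 yx y'x].
have xy : x ^ y = x^-1 * y ^+ 2 by rewrite conjgE mulgA y'x mulgA.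
(* The relations give x y y = y^-1 x^-1 y = y^-1 y^-1 x, and y^-2 = y^2. *)
have xyy : commute x (y ^+ 2).
  have xyE : x * y = y^-1 * x^-1.
    by rewrite -{1}[y](mulgK x) yx !mulgA mulgV mul1g.
  have yyV : y^-1 * y^-1 = y * y.
    by apply/eqP; rewrite -invMg eq_invg_mul -mulgA; apply/eqP.
  by rewrite /commute expgS expg1 mulgA xyE -mulgA -y'x mulgA yyV.
exists x, (y ^+ 2), y; rewrite commg_conj xy invMg invgK -mulgA; split=> //.
  split=> //.
  - by rewrite -joingA cycleX_joing.
  - exact/commute_sym/commuteX.
  - by rewrite xy groupM ?groupV // mem_gen // inE cycle_id ?orbT.
  by rewrite mem_gen // inE cycle_id orbT.
by rewrite -expgM.
Qed.

Lemma is_SD_generators n (gT : finGroupType) (G : {group gT}) : is_SD n G ->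
  exists x t, [/\ inverting_generators G x 1 t, x ^+ (4 * n) = 1
                & [~ t, x] = (x ^+ (2 * n - 1))^-1 * x].
Proof.
move/isoGrp_hom/existsP=> [[x y] /=] /eqP[GE xn y2 yxy].
have xy : x ^ y = x ^+ (2 * n - 1).
  rewrite -yxy conjgE -mulgA; congr (_ * _).
  by apply/eqP; rewrite eq_invg_mul -y2.
exists x, y; rewrite commg_conj xy; split=> //; split=> //.
- by rewrite cycle1 joingG1.
- exact: commute1.
- exact: commute_sym (commute1 _).
- by rewrite xy groupX // mem_gen // inE cycle_id.
by rewrite y2.
Qed.

Lemma order_leq (gT : finGroupType) (x : gT) n : 0 < n -> x ^+ n = 1 ->
  #[x] <= n.
Proof. by move=> n0 xn; apply: dvdn_leq => //; rewrite order_dvdn xn. Qed.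

Lemma ccc_energies_le (C : numClosedFieldType) (gT : finGroupType)
    (G : {group gT}) : in_DQUVSD G ->
  (energy C (CCC G) <= lap_energy C (CCC G))%R /\
  (slap_energy C (CCC G) <= lap_energy C (CCC G))%R.
Proof.
have le_of x s t : inverting_generators G x s t ->
    (energy C (CCC G) <= lap_energy C (CCC G))%R /\
    (slap_energy C (CCC G) <= lap_energy C (CCC G))%R.
  by case/(inverting_generators_energies C) => en_le slap_le _; exact: conj.
case=> [[n _ /is_D_generators[x [t [/le_of genG _ _ _]]]]
       |[m _ /is_Q_generators[x [t [/le_of genG _ _]]]]
       |[n [m [_ _ /is_U_generators[x [s [t [/le_of genG _ _]]]]]]]|].
- exact: genG.
- exact: genG.
- exact: genG.
case=> -[n _]; first by case/is_V_generators=> x [s [t [/le_of]]].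
by case/is_SD_generators=> x [t [/le_of]].
Qed.

(** Except for D_10, the relations bound the order of [t, x] by 3. *)
Lemma ccc_energies_eq (C : numClosedFieldType) (gT : finGroupType)
    (G : {group gT}) :
  is_D 3 G \/ is_D 4 G \/ is_D 5 G \/ is_D 6 G
  \/ is_Q 2 G \/ is_Q 3 G \/ is_V 2 G \/ is_SD 3 G
  \/ (exists n m : nat,
        (2 <= n)%N /\ (m = 2 \/ m = 3 \/ m = 4) /\ is_U n m G) ->
  lap_energy C (CCC G) = slap_energy C (CCC G).
Proof.
have D_small n : is_D n G -> n \in [:: 3; 4; 5; 6] ->
    lap_energy C (CCC G) = slap_energy C (CCC G).
  move/is_D_generators=> [x [t [/(inverting_generators_energies C)[_ _ eqG]]]].
  move=> xn _ txE n_small; apply: eqG; rewrite txE.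
  rewrite cycle1 joingG1 -orderE.
  move: n_small; rewrite !inE => /or4P[] /eqP nE; rewrite {}nE in xn.
  - by left; apply: order_leq; rewrite // -expgM mulnC expgM xn expg1n.
  - by left; apply: leq_trans (order_leq (n := 2) _ _) _; rewrite // -expgM.
  (* For D_10 the order is 1 or 5, and [A] has at most 5 elements. *)
  - have : #[x ^+ 2] %| 5.
      by rewrite order_dvdn -expgM mulnC expgM xn expg1n.
    case/primeP: (isT : prime 5) => _ /[apply] /orP[] /eqP ->; first by left.
    by right; rewrite order_leq.
  by left; apply: order_leq; rewrite // -expgM.
have Q_small m : is_Q m G -> m \in [:: 2; 3] ->
    lap_energy C (CCC G) = slap_energy C (CCC G).
  move/is_Q_generators=> [x [t [/(inverting_generators_energies C)[_ _ eqG]]]].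
  move=> xm txE m_small; apply: eqG; rewrite txE; left.
  apply: leq_trans (order_leq (n := m) _ _) _; rewrite -?expgM //;
  by move: m_small; rewrite !inE => /orP[] /eqP->.
case=> [|[|[|[|[|[|[|[|]]]]]]]]; try by move/D_small; apply.
- by move/Q_small; apply.
- by move/Q_small; apply.
- move/is_V_generators=> [x [s [t [genG x4 s2 xs txE]]]].
  have [_ _ eqG] := inverting_generators_energies C genG.
  apply: eqG; rewrite txE; left.
  apply: leq_trans (order_leq (n := 2) _ _) _; rewrite // expgMn.
    by rewrite expgVn s2 invg1 mul1g -expgM.
  by apply: commuteX; apply/commute_sym/commuteV.
- move/is_SD_generators=> [x [t [/(inverting_generators_energies C)[_ _ eqG]]]].
  move=> x12 txE; apply: eqG; rewrite txE; left; apply: order_leq => //.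
  rewrite (_ : (x ^+ (2 * 3 - 1))^-1 * x = (x ^+ 4)^-1).
    by rewrite expgVn -expgM x12 invg1.
  by rewrite (_ : 2 * 3 - 1 = 4.+1)%N // expgS invMg mulgKV.
case=> n [m [_ [m_small /is_U_generators]]].
move=> [x [s [t [/(inverting_generators_energies C)[_ _ eqG]]]]].
move=> xm txE; apply: eqG; rewrite txE; left.
case: m_small => [|[]] mE; rewrite {}mE in xm.
- by rewrite xm order1.
- by apply: order_leq; rewrite // -expgM mulnC expgM xm expg1n.
by apply: leq_trans (order_leq (n := 2) _ _) _; rewrite // -expgM.
Qed.

(** Exact orders are required here: if [x] were 1, [G] would have at most two elements, so [x] has
    order 7 and the profile is z = 1, c = 7. *)
Lemma D14_energies (C : numClosedFieldType) (gT : finGroupType)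
    (G : {group gT}) : is_D 7 G -> #|G| = 14 ->
  (slap_energy C (CCC G) < lap_energy C (CCC G))%R.
Proof.
move/is_D_generators=> [x [t [genG x7 t2 txE]]] G14.
have GE : <[x]> <*> <[t]> = G.
  by case: genG => <- _ _ _ _; rewrite cycle1 joingG1.
have x_ord : #[x] = 7.
  have : #[x] %| 7 by rewrite order_dvdn x7.
  case/primeP: (isT : prime 7) => _ /[apply] /orP[|/eqP//].
  rewrite order_eq1 => /eqP x1.
  have : #[t] <= 2 by apply: order_leq.
  by rewrite x1 cycle1 joing1G in GE; rewrite orderE GE G14.
have x2_ord : #[x ^+ 2] = 7 by rewrite orderXgcd x_ord.
have nabG : ~~ abelian G.
  apply/negP=> /centsP abG; have : [~ t, x] == 1.
    by apply/commgP/abG; rewrite -GE mem_gen // inE cycle_id ?orbT.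
  by rewrite txE -order_eq1 x2_ord.
have [f [z [fE fz zc]]] := inverting_generators_profile genG nabG.
rewrite cycle1 joingG1 -orderE txE x2_ord x_ord in fz zc.
rewrite (lap_energy_clique_union C fE) (slap_energy_clique_union C fE) ltr_rat.
by apply: ccc_profile_7 fz _ _ => //; lia.
Qed.

Theorem mainTheorem12 (C : numClosedFieldType) :
  (forall (gT : finGroupType) (G : {group gT}), in_DQUVSD G ->
     (energy C (CCC G) <= lap_energy C (CCC G))%R
     /\ (slap_energy C (CCC G) <= lap_energy C (CCC G))%R)
  /\ (forall (gT : finGroupType) (G : {group gT}),
        (is_D 3 G \/ is_D 4 G \/ is_D 5 G \/ is_D 6 G
         \/ is_Q 2 G \/ is_Q 3 G \/ is_V 2 G \/ is_SD 3 G
         \/ (exists n m : nat,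
               (2 <= n)%N /\ (m = 2 \/ m = 3 \/ m = 4) /\ is_U n m G)) ->
        lap_energy C (CCC G) = slap_energy C (CCC G))
  /\ ~ (forall (gT : finGroupType) (G : {group gT}), in_DQUVSD G ->
          (lap_energy C (CCC G) <= slap_energy C (CCC G))%R).
Proof.
split; first exact: ccc_energies_le.
split=> [gT G|lap_le]; first exact: ccc_energies_eq.
(* D_14 is the counterexample. The presentation in [Grp_dihedral] uses [x ^ y], which equals
   [y * x * y] because y^2 = 1. *)
have D14 : is_D 7 [set: 'D_14].
  move=> rT H; rewrite (@Grp_dihedral 7) //; apply: eq_existsb => -[x y] /=.
  rewrite !xpair_eqE; do 2 congr (_ && _); apply: andb_id2l => /eqP y2.
  have yV : y^-1 = y by apply/eqP; rewrite eq_invg_mul -y2.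
  by rewrite conjgE yV mulgA.
have card14 : #|[set: 'D_14]| = 14 by rewrite (@card_dihedral 7).
have := lap_le _ _ (Or41 _ _ _ (ex_intro2 _ _ 7 isT D14)).
by rewrite (lt_geF (D14_energies C D14 card14)).
Qed.
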